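(* Let $G$ be a simple connected undirected graph with $n\ge 2$ vertices, resistance degrees $R_1,\dots,R_n$ and second resistance degrees $T_1,\dots,T_n$. Then $$E_R(G)\ge 2\sqrt{\frac{T_1^2+\cdots+T_n^2}{R_1^2+\cdots+R_n^2}},$$ and equality holds if and only if $G$ is pseudo resistance regular.
   Context: For a connected graph $G$ with vertices $v_1,\dots,v_n$, Laplacian matrix $L$ (degree matrix minus adjacency matrix) and Moore-Penrose inverse $L^\dagger=(l^\dagger_{ij})$, the resistance distance is $r_{ij}=l^\dagger_{ii}+l^\dagger_{jj}-2l^\dagger_{ij}$, and the resistance distance matrix is $R(G)=(r_{ij})_{n\times n}$. The resistance degrees are $R_i=\sum_{j=1}^n r_{ij}$ and the second resistance degrees are $T_i=\sum_{j=1}^n r_{ij}R_j$. $G$ is pseudo resistance regular if there is a constant $k$ with $T_i/R_i=k$ for all $i$. The resistance energy $E_R(G)$ is the sum of the absolute values of the eigenvalues of $R(G)$, counted with multiplicity. *)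

(* Defs.v *)
From HB Require Import structures.
From mathcomp Require Import all_boot all_order all_algebra.
From mathcomp Require Import complex.

Set Implicit Arguments.
Unset Strict Implicit.
Unset Printing Implicit Defensive.

Import Order.TTheory GRing.Theory Num.Theory.
Local Open Scope ring_scope.

Definition simple_graph n (e : rel 'I_n) : Prop := symmetric e /\ irreflexive e.

Definition connected_graph n (e : rel 'I_n) : Prop :=
  forall i j : 'I_n, connect e i j.

Section MoorePenrose.

Variable R : rcfType.

(* The four Penrose equations, for a real matrix. *)
Definition penrose m n (A : 'M[R]_(m, n)) (X : 'M[R]_(n, m)) : bool :=
  [&& A *m X *m A == A, X *m A *m X == X,
      (A *m X)^T == A *m X & (X *m A)^T == X *m A].

Lemma row_free_gram_unit m n (F : 'M[R]_(m, n)) :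
  row_free F -> F *m F^T \in unitmx.
Proof.
move=> freeF; rewrite -row_free_unit; apply: inj_row_free => v vFF0.
apply: (row_free_inj freeF); rewrite mul0mx.
have: (v *m F) *m (v *m F)^T = 0.
  by rewrite trmx_mul mulmxA -(mulmxA v) vFF0 mul0mx.
move/matrixP/(_ 0 0); rewrite !mxE => /eqP.
rewrite psumr_eq0 => [/allP sq0|j _]; last by rewrite [_^T _ _]mxE -expr2 sqr_ge0.
apply/rowP=> j; rewrite [RHS]mxE.
have := sq0 j (mem_index_enum j).
by rewrite implyTb [_^T _ _]mxE mulf_eq0 orbb => /eqP.
Qed.

Lemma penrose_exists m n (A : 'M[R]_(m, n)) : exists X, penrose A X.
Proof.
pose C := col_base A; pose F := row_base A.
have uF : F *m F^T \in unitmx by apply/row_free_gram_unit/row_base_free.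
have uC : C^T *m C \in unitmx.
  rewrite -[X in _ *m X]trmxK; apply: row_free_gram_unit.
  by rewrite /row_free mxrank_tr; have := col_base_full A; rewrite /row_full.
pose Fi := F^T *m invmx (F *m F^T); pose Ci := invmx (C^T *m C) *m C^T.
have FFi : F *m Fi = 1%:M by rewrite mulmxA mulmxV.
have CiC : Ci *m C = 1%:M by rewrite -mulmxA mulVmx.
have AX : C *m F *m (Fi *m Ci) = C *m Ci by rewrite mulmxA -(mulmxA C) FFi mulmx1.
have XA : Fi *m Ci *m (C *m F) = Fi *m F by rewrite mulmxA -(mulmxA Fi) CiC mulmx1.
have defA : A = C *m F by rewrite mulmx_base.
clearbody C F; move: (\rank A) C F uF uC @Fi @Ci FFi CiC AX XA defA => r C F.
move=> uF uC Fi Ci FFi CiC AX XA ->.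
exists (Fi *m Ci); rewrite /penrose AX XA.
apply/and4P; split; apply/eqP.
- by rewrite mulmxA -(mulmxA C) CiC mulmx1.
- by rewrite mulmxA -(mulmxA Fi) FFi mulmx1.
- by rewrite /Ci !trmx_mul trmxK trmx_inv trmx_mul trmxK mulmxA.
- by rewrite /Fi !trmx_mul trmxK trmx_inv trmx_mul trmxK mulmxA.
Qed.

Lemma penrose_unique m n (A : 'M[R]_(m, n)) X Y :
  penrose A X -> penrose A Y -> X = Y.
Proof.
case/and4P=> /eqP AXA /eqP XAX /eqP AXt /eqP XAt.
case/and4P=> /eqP AYA /eqP YAY /eqP AYt /eqP YAt.
have AXY : A *m X = A *m Y.
  by rewrite -[LHS]AXt -{1}AYA -[in LHS]mulmxA trmx_mul AXt AYt mulmxA AXA.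
have XYA : X *m A = Y *m A.
  by rewrite -[LHS]XAt -{1}AYA -[A *m Y *m A]mulmxA mulmxA trmx_mul XAt YAt
    -mulmxA [A *m _]mulmxA AXA.
by rewrite -XAX XYA -mulmxA AXY mulmxA YAY.
Qed.

Definition moore_penrose m n (A : 'M[R]_(m, n)) : 'M[R]_(n, m) :=
  xchoose (penrose_exists A).

Lemma moore_penroseP m n (A : 'M[R]_(m, n)) : penrose A (moore_penrose A).
Proof. exact: xchooseP. Qed.

End MoorePenrose.

(* Complex eigenvalues of a real matrix, listed with algebraic multiplicity:
   the roots of the (monic) characteristic polynomial over R[i]. *)
Definition eigenvalues (R : rcfType) n (A : 'M[R]_n) : seq R[i] :=
  sval (closed_field_poly_normal (char_poly (map_mx (real_complex R) A))).

Lemma eigenvaluesP (R : rcfType) n (A : 'M[R]_n) :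
  char_poly (map_mx (real_complex R) A) =
  \prod_(z <- eigenvalues A) ('X - z%:P).
Proof.
rewrite /eigenvalues; case: closed_field_poly_normal => s /= {1}->.
by rewrite (monicP (char_poly_monic _)) scale1r.
Qed.

(* ComplexField.Normc.normc is the R-valued modulus; the generic norm `|z|
   would take its values in R[i]. *)
Definition energy (R : rcfType) n (A : 'M[R]_n) : R :=
  \sum_(z <- eigenvalues A) ComplexField.Normc.normc z.

Section Resistance.

Variables (R : rcfType) (n : nat) (e : rel 'I_n).

Definition adjacency : 'M[R]_n := \matrix_(i, j) (e i j)%:R.

Definition degree (i : 'I_n) : nat := #|[set j | e i j]|.

Definition laplacian : 'M[R]_n := diag_mx (\row_i (degree i)%:R) - adjacency.

Definition resistance (i j : 'I_n) : R :=
  let Lp := moore_penrose laplacian in Lp i i + Lp j j - 2 * Lp i j.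

Definition resistance_matrix : 'M[R]_n := \matrix_(i, j) resistance i j.

Definition resistance_degree (i : 'I_n) : R := \sum_j resistance i j.

Definition second_resistance_degree (i : 'I_n) : R :=
  \sum_j resistance i j * resistance_degree j.

Definition resistance_energy : R := energy resistance_matrix.

Definition pseudo_resistance_regular : Prop :=
  exists k : R, forall i : 'I_n,
    second_resistance_degree i / resistance_degree i = k.

End Resistance.

(* Main.v *)
Require Import Defs.
From HB Require Import structures.
From mathcomp Require Import all_boot all_order all_algebra.
From mathcomp Require Import complex.
From mathcomp Require Import ring lra.

Set Implicit Arguments.
Unset Strict Implicit.
Unset Printing Implicit Defensive.

Import Order.TTheory GRing.Theory Num.Theory.
Local Open Scope ring_scope.

(** The matrix [M] of resistance distances equals [d 1^T + 1 d^T - 2 L^+], where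
    [d] is the diagonal of [L^+].  On the vectors [x] whose coordinates sum to [0]
    its quadratic form is therefore [- 2 x L^+ x^T], and this is negative for
    [x != 0]: [L^+] is positive semidefinite because [L] is, and its kernel is that
    of [L], the constant vectors, because the graph is connected.  So [M] is
    symmetric, has zero diagonal and is strictly conditionally negative definite
    ([resistance_cnd]); taking [x = e_i - e_j] also gives [r_ij > 0].

    Two orthogonal eigenvectors span a plane that contains a nonzero zero-sum
    vector, so at most one eigenvalue of such a matrix is nonnegative
    ([strictly_cnd_spectral]).  As the trace is [0], exactly one eigenvalue [l] is
    positive, and the energy is [2 l] ([energy_strictly_cnd]).  Moreover
    [|mu| <= l] for every other eigenvalue [mu], with strict inequality as soon as
    there are at least three eigenvalues, because [l] is the sum of these [|mu|] and
    none of them vanishes.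

    Let [r] be the vector of resistance degrees, so that [r M] is the vector of
    second resistance degrees.  Then [|r M| <= l |r|], which is the bound.  If
    equality holds and [n >= 3], then [r] is an eigenvector for [l], i.e. the graph
    is pseudo resistance regular; for [n = 2] this regularity is automatic.
    Conversely, a pseudo resistance regular graph makes [r] an eigenvector for
    some [k >= 0]; since [l] is the only nonnegative eigenvalue, [k = l], and the
    two sides agree. *)

(** * Spectral decomposition of a real symmetric matrix *)

Local Open Scope sesquilinear_scope.

(** The squared modulus of a complex number, as an element of the real field. *)
Definition normsq (R : rcfType) (z : R[i]) : R := complex.Re z ^+ 2 + complex.Im z ^+ 2.

Lemma normsq_ge0 (R : rcfType) (z : R[i]) : 0 <= normsq z.
Proof. by rewrite addr_ge0 ?sqr_ge0. Qed.

Lemma mul_conj_normsq (R : rcfType) (z : R[i]) :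
  z * Num.conj z = real_complex R (normsq z).
Proof. by rewrite -normCK /normsq add_Re2_Im2. Qed.

Lemma normsqM_real (R : rcfType) (a : R) (z : R[i]) :
  normsq (z * real_complex R a) = normsq z * a ^+ 2.
Proof. case: z => x y; rewrite /normsq /=; ring. Qed.

(** The eigenvalues are recorded in the real field, while the orthonormal basis of
    eigenvectors, the rows of [P], has complex coordinates. *)
Lemma spectral_real_symmetric (R : rcfType) n (A : 'M[R]_n) :
  A^T = A -> exists (P : 'M[R[i]]_n) (d : 'rV[R]_n),
    P *m P ^t* = 1%:M /\
    map_mx (real_complex R) A =
      P ^t* *m diag_mx (map_mx (real_complex R) d) *m P.
Proof.
move=> symA; set Ac := map_mx _ A.
have hermA : Ac \is hermsymmx.
  apply: realsym_hermsym.
    by apply/is_hermitianmxP; rewrite expr0 scale1r; apply/matrixP => i j;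
      rewrite !mxE -[in LHS]symA mxE.
  by apply/mxOverP => i j; rewrite mxE; apply/complex_realP; exists (A i j).
have := hermitian_normalmx hermA => /orthomx_spectralP defA.
have realD := hermitian_spectral_diag_real hermA.
exists (spectralmx Ac), (map_mx (@complex.Re R) (spectral_diag Ac)); split.
  exact/unitarymxP/spectral_unitarymx.
rewrite (invmx_unitary (spectral_unitarymx Ac)) in defA.
apply: etrans defA _; congr (_ *m diag_mx _ *m _).
by apply/rowP => i; rewrite !mxE RRe_real //; exact: (mxOverP realD).
Qed.

Section Spectral.

Variables (R : rcfType) (n : nat) (A : 'M[R]_n).
Variables (P : 'M[R[i]]_n) (d : 'rV[R]_n).
Hypothesis unitP : P *m P ^t* = 1%:M.
Local Notation C := (real_complex R).
Hypothesis defA : map_mx C A = P ^t* *m diag_mx (map_mx C d) *m P.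

Let unitP' : P ^t* *m P = 1%:M.
Proof. exact: mulmx1C. Qed.

Lemma eigenvalues_spectral : perm_eq (eigenvalues A) [seq C (d 0 i) | i : 'I_n].
Proof.
apply: prod_XsubC_eq; rewrite -eigenvaluesP.
have -> : char_poly (map_mx C A) = char_poly (diag_mx (map_mx C d)).
  rewrite /char_poly /char_poly_mx.
  have -> : 'X%:M - map_mx polyC (map_mx C A) = map_mx polyC (P ^t*) *m
      ('X%:M - map_mx polyC (diag_mx (map_mx C d))) *m map_mx polyC P.
    rewrite defA !map_mxM mulmxBr mulmxBl; congr (_ - _).
    by rewrite scalar_mxC -mulmxA -map_mxM unitP' map_mx1 mulmx1.
  rewrite !det_mulmx mulrC mulrA -det_mulmx -map_mxM unitP map_mx1 det1.
  by rewrite mul1r.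
rewrite char_poly_trig ?diag_mx_is_trig // big_map big_enum /=.
by apply: eq_bigr => i _; rewrite !mxE eqxx mulr1n.
Qed.

Lemma energy_spectral : energy A = \sum_i `|d 0 i|.
Proof.
rewrite /energy (perm_big _ eigenvalues_spectral) big_map big_enum /=.
by apply: eq_bigr => i _; rewrite /= expr0n /= addr0 sqrtr_sqr.
Qed.

Lemma trace_spectral : \tr A = \sum_i d 0 i.
Proof.
apply: (@complexI R); rewrite -trace_map_mx defA mxtrace_mulC mulmxA unitP mul1mx.
by rewrite mxtrace_diag rmorph_sum; apply: eq_bigr => i _; rewrite mxE.
Qed.

(** The spectral measure of [A] at [x]: [w i] is the squared modulus of the
    coordinate of [x] along the [i]-th eigenvector, and each equality is Parseval's
    identity for a combination of [x] and [x *m A]. *)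
Lemma spectral_measure (x : 'rV[R]_n) : exists w : 'I_n -> R,
  [/\ forall i, 0 <= w i,
      \sum_j x 0 j ^+ 2 = \sum_i w i,
      \sum_j (x *m A) 0 j ^+ 2 = \sum_i w i * d 0 i ^+ 2 &
      forall k, \sum_j (x *m A - k *: x) 0 j ^+ 2 =
                \sum_i w i * (d 0 i - k) ^+ 2].
Proof.
pose c := map_mx C x *m P ^t*.
have parseval a b : \sum_j (a *: (x *m A) + b *: x) 0 j ^+ 2 =
    \sum_i normsq (c 0 i) * (a * d 0 i + b) ^+ 2.
  set y := _ + _.
  have yP : map_mx C y *m P ^t* = \row_i (c 0 i * C (a * d 0 i + b)).
    rewrite map_mxD !map_mxZ map_mxM defA mulmxDl -!scalemxAl -!mulmxA unitP.
    rewrite mulmx1 !mulmxA -/c mul_mx_diag; apply/rowP => i; rewrite !mxE.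
    by rewrite rmorphD rmorphM; ring.
  apply: (@complexI R); rewrite !rmorph_sum.
  transitivity ((map_mx C y *m (map_mx C y) ^t*) 0 0).
    rewrite mxE; apply: eq_bigr => j _; rewrite !mxE.
    by rewrite mul_conj_normsq /normsq /= expr0n addr0.
  transitivity (((map_mx C y *m P ^t*) *m (map_mx C y *m P ^t*) ^t*) 0 0).
    by rewrite trmx_mul map_mxM trmxCK mulmxA -(mulmxA _ _ P) unitP' mulmx1.
  rewrite yP mxE; apply: eq_bigr => j _; rewrite !mxE mul_conj_normsq.
  by rewrite normsqM_real.
exists (fun i => normsq (c 0 i)); split=> [i|||k]; first exact: normsq_ge0.
- have := parseval 0 1; rewrite scale0r scale1r add0r => ->.
  by apply: eq_bigr => i _; rewrite mul0r add0r expr1n mulr1.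
- have := parseval 1 0; rewrite scale0r scale1r addr0 => ->.
  by apply: eq_bigr => i _; rewrite mul1r addr0.
- have := parseval 1 (- k); rewrite scale1r scaleNr => ->.
  by apply: eq_bigr => i _; rewrite mul1r.
Qed.

End Spectral.

(** * Strictly conditionally negative definite matrices *)

(** The quadratic form of [M] is negative at the nonzero vectors whose coordinates
    sum to zero. *)
Definition strictly_cnd (R : rcfType) n (M : 'M[R]_n) : Prop :=
  forall x : 'rV[R]_n, \sum_i x 0 i = 0 -> x != 0 ->
    \sum_i \sum_j x 0 i * M i j * x 0 j < 0.

(** The Hermitian form of [M] at [z] is the sum of the quadratic forms at the real
    and imaginary parts of [z]. *)
Lemma strictly_cnd_complex (R : rcfType) n (M : 'M[R]_n) (z : 'rV[R[i]]_n) :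
  strictly_cnd M -> \sum_i z 0 i = 0 -> z != 0 ->
  complex.Re ((z *m map_mx (real_complex R) M *m z ^t*) 0 0) < 0.
Proof.
move=> cnd sumz z0.
pose u := map_mx (@complex.Re R) z; pose v := map_mx (@complex.Im R) z.
have ReD : {morph (@complex.Re R) : x y / x + y >-> x + y} by case=> [? ?] [].
have ImD : {morph (@complex.Im R) : x y / x + y >-> x + y} by case=> [? ?] [].
have sumu : \sum_i u 0 i = 0.
  under eq_bigr do rewrite mxE.
  by rewrite -(big_morph _ ReD (erefl : complex.Re 0 = 0)) sumz.
have sumv : \sum_i v 0 i = 0.
  under eq_bigr do rewrite mxE.
  by rewrite -(big_morph _ ImD (erefl : complex.Im 0 = 0)) sumz.
have -> : complex.Re ((z *m map_mx (real_complex R) M *m z ^t*) 0 0) =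
    \sum_i \sum_j u 0 i * M i j * u 0 j + \sum_i \sum_j v 0 i * M i j * v 0 j.
  rewrite mxE (big_morph _ ReD (erefl : complex.Re 0 = 0)) exchange_big.
  rewrite [X in _ + X]exchange_big -big_split; apply: eq_bigr => j _.
  rewrite !mxE mulr_suml (big_morph _ ReD (erefl : complex.Re 0 = 0)) -big_split.
  apply: eq_bigr => i _; rewrite !mxE.
  by case: (z 0 i) (z 0 j) => [a b] [a' b'] /=; ring.
have le0 (x : 'rV[R]_n) : \sum_i x 0 i = 0 ->
    \sum_i \sum_j x 0 i * M i j * x 0 j <= 0.
  move=> sumx; have [->|x0] := eqVneq x 0; last exact/ltW/cnd.
  by rewrite big1 // => i _; rewrite big1 // => j _; rewrite mxE mul0r mul0r.
have [u0|u0] := eqVneq u 0; last by rewrite ltr_wnDr ?le0 ?cnd.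
rewrite ltr_wnDl ?le0 ?cnd //; apply: contra_neq z0 => v0.
apply/rowP => i; move/rowP/(_ i): u0; move/rowP/(_ i): v0; rewrite !mxE.
by case: (z 0 i) => a b /= -> ->.
Qed.

(** At most one eigenvalue is nonnegative. *)
Lemma strictly_cnd_spectral (R : rcfType) n (M : 'M[R]_n) (P : 'M[R[i]]_n) (d : 'rV[R]_n) :
    strictly_cnd M -> P *m P ^t* = 1%:M ->
    map_mx (real_complex R) M =
      P ^t* *m diag_mx (map_mx (real_complex R) d) *m P ->
  forall i j, i != j -> 0 <= d 0 i -> d 0 j < 0.
Proof.
move=> cnd unitP defM i j neq_ij di; rewrite ltNge; apply/negP => dj.
pose s k := \sum_l P k l.
(* [c] holds the coordinates, in the eigenbasis, of a nonzero zero-sum vector in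
   the span of the [i]-th and [j]-th eigenvectors. *)
have [c [c0 sumc suppc]] : exists c : 'rV[R[i]]_n,
    [/\ c != 0, \sum_k c 0 k * s k = 0 & forall k, k != i -> k != j -> c 0 k = 0].
  have delta_s k : \sum_l (delta_mx 0 k : 'rV[R[i]]_n) 0 l * s l = s k.
    rewrite (bigD1 k) //= mxE !eqxx mul1r big1 ?addr0 // => l /negPf nk.
    by rewrite mxE nk andbF mul0r.
  have [si|si] := eqVneq (s i) 0.
    exists (delta_mx 0 i); split; last by move=> k /negPf nk _; rewrite mxE nk andbF.
      by apply/eqP => /rowP/(_ i)/eqP; rewrite !mxE !eqxx oner_eq0.
    by rewrite delta_s.
  exists (s j *: delta_mx 0 i - s i *: delta_mx 0 j); split.
  - apply/eqP => /rowP/(_ j)/eqP; rewrite !mxE !eqxx (eq_sym j i) (negPf neq_ij).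
    by rewrite mulr0 mulr1 add0r oppr_eq0 (negPf si).
  - transitivity (\sum_k (s j * ((delta_mx 0 i : 'rV_n) 0 k * s k)
        - s i * ((delta_mx 0 j : 'rV_n) 0 k * s k))).
      by apply: eq_bigr => k _; rewrite !mxE; ring.
    by rewrite sumrB -!mulr_sumr !delta_s mulrC subrr.
  - by move=> k /negPf ni /negPf nj; rewrite !mxE ni nj !andbF !mulr0 subr0.
have z0 : c *m P != 0.
  apply: contra_neq c0 => /(congr1 (mulmx^~ (P ^t*))).
  by rewrite -mulmxA unitP mulmx1 mul0mx.
have sumz : \sum_l (c *m P) 0 l = 0.
  under eq_bigr do rewrite mxE.
  rewrite exchange_big -[RHS]sumc; apply: eq_bigr => k _.
  by rewrite mulr_sumr.
have := strictly_cnd_complex cnd sumz z0; rewrite defM.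
rewrite trmx_mul map_mxM !mulmxA -(mulmxA c) unitP mulmx1.
rewrite -(mulmxA _ P) unitP mulmx1.
have -> : (c *m diag_mx (map_mx (real_complex R) d) *m c ^t*) 0 0 =
   real_complex R (\sum_k normsq (c 0 k) * d 0 k).
  rewrite rmorph_sum mxE; apply: eq_bigr => k _; rewrite mul_mx_diag !mxE.
  by rewrite rmorphM /= -mul_conj_normsq; ring.
apply/negP; rewrite -leNgt sumr_ge0 // => k _.
have [->|ni] := eqVneq k i; first by rewrite mulr_ge0 ?normsq_ge0.
have [->|nj] := eqVneq k j; first by rewrite mulr_ge0 ?normsq_ge0.
by rewrite suppc // /normsq /= expr0n addr0 mul0r.
Qed.

Lemma exists_notin n (s : {set 'I_n}) : (#|s| < n)%N -> exists k, k \notin s.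
Proof.
move=> ltsn; apply/existsP; apply: contraTT ltsn.
rewrite negb_exists -leqNgt => /forallP alls.
have -> : s = [set: 'I_n] by apply/setP => k; rewrite inE -[_ \in _]negbK alls.
by rewrite cardsT card_ord.
Qed.

(** [l] is the only nonnegative eigenvalue.  Multiplication by [A] scales norms by
    at most [l], and in dimension at least three only the vectors of the eigenspace
    of [l] attain this factor. *)
Lemma energy_strictly_cnd (R : rcfType) n (A : 'M[R]_n) :
    (1 < n)%N -> A^T = A -> \tr A = 0 -> strictly_cnd A ->
  exists l : R, [/\ 0 < l, energy A = 2 * l,
    forall x : 'rV_n, \sum_j (x *m A) 0 j ^+ 2 <= l ^+ 2 * \sum_j x 0 j ^+ 2,
    forall x : 'rV_n, (2 < n)%N ->
      \sum_j (x *m A) 0 j ^+ 2 = l ^+ 2 * \sum_j x 0 j ^+ 2 -> x *m A = l *: x &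
    forall (x : 'rV_n) (k : R), x != 0 -> 0 <= k -> x *m A = k *: x -> k = l].
Proof.
move=> n1 symA trA cnd.
have [P [d [unitP defA]]] := spectral_real_symmetric symA.
have dneg := strictly_cnd_spectral cnd unitP defA.
have sumd : \sum_i d 0 i = 0 by rewrite -(trace_spectral unitP defA).
(* A nonnegative eigenvalue exists because the trace vanishes. *)
have [i0 d0] : exists i0, 0 <= d 0 i0.
  apply/existsP; apply/contraT; rewrite negb_exists => /forallP dlt.
  have /eqP := sumd; rewrite lt_eqF // (bigD1 (Ordinal n1)) //=.
  by apply: ltr_wnDr; [apply: sumr_le0 => i _; apply: ltW|]; rewrite ltNge dlt.
have {}dneg i : i != i0 -> d 0 i < 0 by rewrite eq_sym => /dneg; apply.
have defd0 : d 0 i0 = \sum_(i | i != i0) - d 0 i.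
  by apply/eqP; rewrite sumrN -subr_eq0 opprK; move: sumd; rewrite (bigD1 i0) //= => ->.
have dle i : i != i0 -> - d 0 i <= d 0 i0.
  move=> ni; rewrite defd0 (bigD1 i) //= lerDl sumr_ge0 // => k /andP[nk _].
  by rewrite oppr_ge0 ltW ?dneg.
have dlt i : (2 < n)%N -> i != i0 -> - d 0 i < d 0 i0.
  move=> n2 ni; have [k /andP[nk nki]] : exists k, (k != i0) && (k != i).
    have [|k] := @exists_notin n [set i0; i].
      by rewrite (leq_ltn_trans _ n2) // cards2; case: (_ != _).
    by rewrite !inE negb_or => nk; exists k.
  rewrite defd0 (bigD1 i) //= ltrDl (bigD1 k) ?nk //= ltr_pwDl ?oppr_gt0 ?dneg //.
  by rewrite sumr_ge0 // => m /andP[/andP[nm _] _]; rewrite oppr_ge0 ltW ?dneg.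
have d0gt : 0 < d 0 i0.
  have [k nk] : exists k, k != i0.
    by have [|k] := @exists_notin n [set i0]; rewrite ?cards1 // inE; exists k.
  by apply: lt_le_trans (dle k nk); rewrite oppr_gt0 dneg.
have sqle i : 0 <= d 0 i0 ^+ 2 - d 0 i ^+ 2.
  have [->|ni] := eqVneq i i0; first by rewrite subrr.
  by have := dle i ni; have := dneg i ni; nra.
have shift (x : 'rV[R]_n) k : \sum_j (x *m A - k *: x) 0 j ^+ 2 = 0 -> x *m A = k *: x.
  move=> /eqP; rewrite psumr_eq0 => [/allP z|j _]; last exact: sqr_ge0.
  apply/eqP; rewrite -subr_eq0; apply/eqP/rowP => j; rewrite [RHS]mxE.
  by apply/eqP; rewrite -sqrf_eq0; apply: z; rewrite mem_index_enum.
exists (d 0 i0); split=> //.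
- rewrite (energy_spectral unitP defA) (bigD1 i0) //= ger0_norm //.
  rewrite (eq_bigr (fun i => - d 0 i)) => [|i ni]; last by rewrite ltr0_norm ?dneg.
  by rewrite -defd0 -mulr2n mulr_natl.
- move=> x; have [w [w0 -> -> _]] := spectral_measure unitP defA x.
  rewrite mulr_sumr; apply: ler_sum => i _.
  by rewrite mulrC ler_wpM2r ?w0 // -subr_ge0.
- move=> x n2; have [w [w0 -> -> mom]] := spectral_measure unitP defA x.
  move=> eqw; apply: shift; rewrite mom big1 // => i _.
  (* By equality, [x] has no component where [d 0 i ^+ 2 < d 0 i0 ^+ 2], that is
     for every [i != i0]. *)
  have [->|ni] := eqVneq i i0; first by rewrite subrr expr0n mulr0.
  have /eqP : \sum_i w i * (d 0 i0 ^+ 2 - d 0 i ^+ 2) = 0.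
    under eq_bigr do rewrite mulrBr.
    rewrite sumrB eqw mulr_sumr; apply/eqP; rewrite subr_eq0; apply/eqP.
    by apply: eq_bigr => j _; rewrite mulrC.
  rewrite psumr_eq0 => [/allP/(_ i (mem_index_enum i))|j _]; last first.
    by rewrite mulr_ge0 ?w0 ?sqle.
  rewrite implyTb mulf_eq0 => /orP[/eqP->|/eqP eqd]; first by rewrite mul0r.
  by have := dlt i n2 ni; have := dneg i ni; nra.
- move=> x k x0 k0 xA; have [w [w0 mom0 _ mom]] := spectral_measure unitP defA x.
  have wk i : w i * (d 0 i - k) ^+ 2 = 0.
    have /eqP := mom k; rewrite xA subrr big1 => [|j _]; last by rewrite mxE expr0n.
    rewrite eq_sym psumr_eq0 => [/allP/(_ i (mem_index_enum i))/eqP//|j _].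
    by rewrite mulr_ge0 ?w0 ?sqr_ge0.
  (* Since [x] is nonzero it has a nonzero component, whose eigenvalue is [k]. *)
  have [i wi] : exists i, w i != 0.
    apply/existsP; apply: contraNT x0; rewrite negb_exists => /forallP w00.
    move/eqP: mom0; rewrite [X in _ == X]big1 => [|j _]; last first.
      by apply/eqP; have := w00 j; rewrite negbK.
    rewrite psumr_eq0 => [/allP z|j _]; last exact: sqr_ge0.
    apply/eqP/rowP => j; rewrite [RHS]mxE; apply/eqP; rewrite -sqrf_eq0.
    by apply: z; rewrite mem_index_enum.
  have /eqP := wk i; rewrite mulf_eq0 (negPf wi) sqrf_eq0 subr_eq0 => /eqP dk.
  by have [<-//|ni] := eqVneq i i0; have := dneg i ni; rewrite dk ltNge k0.
Qed.

(** * The resistance matrix of a connected graph *)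

Lemma penrose_tr (R : rcfType) m (A B : 'M[R]_m) : A^T = A -> penrose A B -> penrose A B^T.
Proof.
move=> symA /and4P[/eqP AXA /eqP XAX /eqP AXt /eqP XAt].
have trAB : A *m B^T = B *m A by rewrite -XAt trmx_mul symA.
have trBA : B^T *m A = A *m B by rewrite -AXt trmx_mul symA.
apply/and4P; split; apply/eqP.
- by apply: trmx_inj; rewrite !trmx_mul trmxK symA mulmxA.
- by apply: trmx_inj; rewrite !trmx_mul trmxK symA mulmxA.
- by rewrite trAB XAt.
- by rewrite trBA AXt.
Qed.

Section ResistanceMatrix.

Variables (R : rcfType) (n : nat) (e : rel 'I_n).
Hypotheses (simple_e : simple_graph e) (conn_e : connected_graph e).

Local Notation L := (laplacian R e).
Local Notation X := (moore_penrose L).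

Lemma laplacian_sym : L^T = L.
Proof.
have [sym_e _] := simple_e.
apply/matrixP => i j; rewrite !mxE sym_e; congr (_ - _).
by case: (eqVneq i j) => [->|]; rewrite ?eqxx // => /negPf nij; rewrite eq_sym nij.
Qed.

(** Both sides are twice the Dirichlet energy, as each edge is counted in both
    directions. *)
Lemma laplacian_form (x : 'rV[R]_n) :
  (x *m L *m x^T) 0 0 *+ 2 = \sum_i \sum_j (e i j)%:R * (x 0 i - x 0 j) ^+ 2.
Proof.
have [sym_e _] := simple_e.
have degE i : (degree e i)%:R = \sum_j (e i j)%:R :> R.
  by rewrite /degree -sum1_card big_mkcond natr_sum; apply: eq_bigr => j _;
    rewrite inE; case: (e i j).
have -> : (x *m L *m x^T) 0 0 =
   \sum_i \sum_j (e i j)%:R * (x 0 i ^+ 2 - x 0 i * x 0 j).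
  rewrite /laplacian mulmxBr mulmxBl mxE [X in _ + X]mxE.
  under [RHS]eq_bigr do under eq_bigr do rewrite mulrBr.
  under [RHS]eq_bigr do rewrite sumrB.
  rewrite [RHS]sumrB; congr (_ - _).
    by rewrite mxE; apply: eq_bigr => i _; rewrite mul_mx_diag !mxE degE -mulr_suml; ring.
  rewrite mxE exchange_big; apply: eq_bigr => j _; rewrite !mxE mulr_suml.
  by apply: eq_bigr => i _; rewrite !mxE; ring.
rewrite mulr2n {1}exchange_big -big_split; apply: eq_bigr => i _.
by rewrite -big_split; apply: eq_bigr => j _; rewrite /= (sym_e j i); ring.
Qed.

Lemma laplacian_psd (x : 'rV[R]_n) : 0 <= (x *m L *m x^T) 0 0.
Proof.
rewrite -(@pmulrn_lge0 _ _ 2) // laplacian_form.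
by do 2!apply: sumr_ge0 => ? _; rewrite mulr_ge0 ?ler0n ?sqr_ge0.
Qed.

Lemma laplacian_form_eq0 (x : 'rV[R]_n) :
  (x *m L *m x^T) 0 0 = 0 -> forall i j, x 0 i = x 0 j.
Proof.
move=> q0.
have edge i j : e i j -> x 0 i = x 0 j.
  move=> eij; have /eqP := laplacian_form x; rewrite q0 mul0rn eq_sym.
  have pos k l : 0 <= (e k l)%:R * (x 0 k - x 0 l) ^+ 2.
    by rewrite mulr_ge0 ?ler0n ?sqr_ge0.
  rewrite psumr_eq0 => [/allP/(_ i (mem_index_enum i))|k _]; last first.
    by rewrite sumr_ge0.
  rewrite implyTb psumr_eq0 => [/allP/(_ j (mem_index_enum j))|//].
  by rewrite implyTb eij mul1r sqrf_eq0 subr_eq0 => /eqP.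
move=> i j; have /connectP[p + ->] := conn_e i j.
by elim: p i => //= k p IHp i /andP[/edge-> /IHp].
Qed.

Lemma const_laplacian (x : 'rV[R]_n) : (forall i j, x 0 i = x 0 j) -> x *m L = 0.
Proof.
move=> constx; apply/rowP => j; rewrite [RHS]mxE -laplacian_sym mxE.
under eq_bigr => i do rewrite (constx i j).
rewrite -mulr_sumr; apply/eqP; rewrite mulf_eq0; apply/orP; right.
under eq_bigr do rewrite !mxE.
rewrite sumrB (bigD1 j) //= eqxx big1 => [|i /negPf ni]; last by rewrite eq_sym ni.
rewrite mulr1n addr0 /degree -sum1_card big_mkcond natr_sum subr_eq0.
by apply/eqP/eq_bigr => i _; rewrite inE; case: (e j i).
Qed.

Lemma pinv_laplacian_sym : X^T = X.
Proof.
apply: penrose_unique (moore_penroseP L).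
exact: penrose_tr laplacian_sym (moore_penroseP L).
Qed.

(** If the form of [L^+] vanishes at [x], then [x L^+] is constant, so that
    [x L = x L^+ L L = 0] and [x] is constant too; the sum condition then gives
    [x = 0]. *)
Lemma pinv_laplacian_form (x : 'rV[R]_n) : \sum_i x 0 i = 0 -> x != 0 ->
  0 < (x *m X *m x^T) 0 0.
Proof.
have /and4P[/eqP LXL /eqP XLX /eqP LXt /eqP XLt] := moore_penroseP L.
move=> sumx x0.
have formE : x *m X *m x^T = (x *m X) *m L *m (x *m X)^T.
  by rewrite trmx_mul pinv_laplacian_sym -{1}XLX !mulmxA.
rewrite formE lt_def laplacian_psd andbT; apply: contra_neq x0.
move/laplacian_form_eq0/const_laplacian => xXL.
have xL : (x *m L *m x^T) 0 0 = 0.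
  have -> : x *m L = x *m X *m L *m L.
    rewrite -[in LHS]LXL !mulmxA -[_ *m L *m X]mulmxA -[x *m X *m L]mulmxA.
    by rewrite -[L *m X]LXt trmx_mul pinv_laplacian_sym laplacian_sym.
  by rewrite xXL !mul0mx mxE.
have constx := laplacian_form_eq0 xL.
apply/rowP => i; rewrite [RHS]mxE; move/eqP: sumx.
under eq_bigr => j do rewrite (constx j i).
rewrite sumr_const cardT size_enum_ord -mulr_natr mulf_eq0 => /orP[/eqP//|].
by rewrite pnatr_eq0 -leqn0 leqNgt (leq_ltn_trans (leq0n i) (ltn_ord i)).
Qed.

Local Notation RM := (resistance_matrix R e).

Lemma resistance_matrix_sym : RM^T = RM.
Proof.
apply/matrixP => i j; rewrite !mxE /resistance -{3}pinv_laplacian_sym mxE; ring.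
Qed.

Lemma resistance_diag i : resistance R e i i = 0.
Proof. rewrite /resistance; ring. Qed.

Lemma resistance_cnd : strictly_cnd RM.
Proof.
move=> x sumx x0; have := pinv_laplacian_form sumx x0.
rewrite -oppr_lt0 -(@pmulrn_llt0 _ _ 2) //; congr (_ < 0).
rewrite !mxE.
transitivity (\sum_i \sum_j (x 0 i * X i i * x 0 j + x 0 i * (X j j * x 0 j)
      - 2 * (x 0 i * X i j * x 0 j))); last first.
  by apply: eq_bigr => i _; apply: eq_bigr => j _; rewrite !mxE /resistance; ring.
under [RHS]eq_bigr do rewrite sumrB big_split /= -!mulr_sumr sumx mulr0 add0r.
rewrite sumrB -mulr_suml sumx mul0r sub0r mulNrn -mulr_sumr mulr_natl.
congr (- (_ *+ _)); rewrite exchange_big; apply: eq_bigr => j _.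
by rewrite !mxE mulr_suml; apply: eq_bigr => i _.
Qed.

Lemma resistance_gt0 i j : i != j -> 0 < resistance R e i j.
Proof.
move=> neq; pose x : 'rV[R]_n := delta_mx 0 i - delta_mx 0 j.
have sumd k (f : 'I_n -> R) : \sum_l (l == k)%:R * f l = f k.
  rewrite (bigD1 k) //= eqxx mul1r big1 ?addr0 // => l /negPf->.
  by rewrite mul0r.
have sumx : \sum_l x 0 l = 0.
  under eq_bigr do rewrite !mxE eqxx /= -[_%:R]mulr1 -[X in _ - X]mulr1.
  by rewrite sumrB !(sumd _ (fun=> 1)) subrr.
have x0 : x != 0.
  by apply/eqP => /rowP/(_ i)/eqP; rewrite !mxE !eqxx (negPf neq) subr0 oner_eq0.
have := resistance_cnd sumx x0.
have -> : \sum_k \sum_l x 0 k * RM k l * x 0 l = - (2 * resistance R e i j).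
  transitivity (\sum_k x 0 k * (RM k i - RM k j)).
    apply: eq_bigr => k _; rewrite -[RM k i](sumd i (RM k)) -[RM k j](sumd j (RM k)).
    rewrite -sumrB mulr_sumr; apply: eq_bigr => l _.
    by rewrite !mxE !eqxx /=; ring.
  transitivity (\sum_k ((k == i)%:R * (RM k i - RM k j)
      - (k == j)%:R * (RM k i - RM k j))).
    by apply: eq_bigr => k _; rewrite !mxE !eqxx /=; ring.
  rewrite sumrB !(sumd _ (fun k => RM k i - RM k j)).
  rewrite -[in RM j i]resistance_matrix_sym !mxE !resistance_diag; ring.
by rewrite oppr_lt0 pmulr_rgt0.
Qed.

Lemma resistance_degree_gt0 : (1 < n)%N -> forall i, 0 < resistance_degree R e i.
Proof.
move=> n1 i; have [k nk] : exists k, i != k.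
  have [|k] := @exists_notin n [set i]; rewrite ?cards1 // inE eq_sym.
  by exists k.
rewrite /resistance_degree (bigD1 k) //= ltr_pwDl ?resistance_gt0 //.
rewrite sumr_ge0 // => j _; have [->|nj] := eqVneq i j.
  by rewrite resistance_diag.
by rewrite ltW ?resistance_gt0.
Qed.

End ResistanceMatrix.

(** On two vertices both resistance degrees are [r_01] by symmetry. *)
Lemma pseudo_resistance_regular2 (R : rcfType) n (e : rel 'I_n) :
  n = 2 -> simple_graph e -> pseudo_resistance_regular R e.
Proof.
move=> n2; subst n => simple_e.
have r10 : resistance R e 1 0 = resistance R e 0 1.
  have /matrixP/(_ 0 1) := resistance_matrix_sym R simple_e.
  by rewrite !mxE.
have deg i : resistance_degree R e i = resistance R e 0 1.
  rewrite /resistance_degree !big_ord_recl big_ord0 /=.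
  have -> : lift ord0 ord0 = 1 :> 'I_2 by apply: val_inj.
  have [->|->] : i = 0 \/ i = 1.
    by case: i => [[|[|]]] //= ?; [left|right]; apply: val_inj.
  - by rewrite resistance_diag addr0 add0r.
  - by rewrite resistance_diag r10 !addr0.
exists (resistance R e 0 1) => i; rewrite /second_resistance_degree.
under eq_bigr do rewrite deg.
rewrite -mulr_suml -/(resistance_degree R e i) deg.
have [->|r0] := eqVneq (resistance R e 0 1) 0; first by rewrite !mul0r.
by rewrite mulfK.
Qed.

Theorem corollary4p3 (R : rcfType) (n : nat) (e : rel 'I_n)
  (hn : (2 <= n)%N) (hsimple : simple_graph e) (hconn : connected_graph e) :
  let bound : R :=
    2 * Num.sqrt ((\sum_i second_resistance_degree R e i ^+ 2) /
                  (\sum_i resistance_degree R e i ^+ 2)) in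
  bound <= resistance_energy R e /\
  (resistance_energy R e = bound <-> pseudo_resistance_regular R e).
Proof.
move=> bound; pose A := resistance_matrix R e.
have symA : A^T = A := resistance_matrix_sym R hsimple.
have trA : \tr A = 0 by apply: big1 => i _; rewrite mxE resistance_diag.
have [l [l0 El sqle sqeq eigl]] :=
  energy_strictly_cnd hn symA trA (resistance_cnd hsimple hconn).
have deg0 := resistance_degree_gt0 R hsimple hconn hn.
pose r := \row_i resistance_degree R e i.
have rA j : (r *m A) 0 j = second_resistance_degree R e j.
  rewrite -symA mxE; apply: eq_bigr => i _.
  by rewrite !mxE mulrC.
rewrite /bound; set T2 := \sum_i second_resistance_degree R e i ^+ 2.
set R2 := \sum_i resistance_degree R e i ^+ 2.
have r2 : \sum_j r 0 j ^+ 2 = R2 by apply: eq_bigr => j _; rewrite mxE.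
have t2 : \sum_j (r *m A) 0 j ^+ 2 = T2 by apply: eq_bigr => j _; rewrite rA.
have {sqle} := sqle r; have {sqeq} := sqeq r; rewrite r2 t2 => sqeq sqle.
have R2gt0 : 0 < R2.
  rewrite /R2 (bigD1 (Ordinal hn)) //= ltr_pwDl ?exprn_gt0 //.
  by rewrite sumr_ge0 // => i _; rewrite sqr_ge0.
have T2ge0 : 0 <= T2 by rewrite sumr_ge0 // => i _; rewrite sqr_ge0.
rewrite /resistance_energy -/A El.
have r0 : r != 0.
  by apply/eqP => /rowP/(_ (Ordinal hn))/eqP; rewrite !mxE gt_eqF.
split.
  rewrite ler_pM2l // -[leRHS](ger0_norm (ltW l0)) -sqrtr_sqr ler_wsqrtr //.
  by rewrite ler_pdivrMr.
split=> [eqE|[k regk]].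
  have /eqP : l = Num.sqrt (T2 / R2) by apply: (mulfI _ eqE); rewrite pnatr_eq0.
  rewrite eq_sym -[X in _ == X](ger0_norm (ltW l0)) -sqrtr_sqr.
  rewrite eqr_sqrt ?divr_ge0 ?sqr_ge0 // ?(ltW R2gt0) // => /eqP eqQ.
  have eqT : T2 = l ^+ 2 * R2 by rewrite -eqQ divfK ?gt_eqF.
  (* For [n = 2] the eigenvalue [- l] also attains the bound, so the eigenvector
     argument does not apply. *)
  have [n2|n2] := ltnP 2 n; last first.
    by apply: pseudo_resistance_regular2 => //; apply/eqP; rewrite eqn_leq n2.
  exists l => i; rewrite -rA (sqeq n2 eqT) !mxE mulfK //.
  by rewrite gt_eqF.
have rk : r *m A = k *: r.
  by apply/rowP => i; rewrite rA !mxE -(regk i) divfK // gt_eqF.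
have k0 : 0 <= k.
  rewrite -(regk (Ordinal hn)) divr_ge0 ?(ltW (deg0 _)) // sumr_ge0 // => j _.
  rewrite mulr_ge0 ?(ltW (deg0 _)) //; have [<-|nj] := eqVneq (Ordinal hn) j.
    by rewrite resistance_diag.
  by rewrite ltW ?resistance_gt0.
have kl := eigl r k r0 k0 rk; rewrite -kl.
have -> : T2 = k ^+ 2 * R2.
  rewrite /T2 /R2 mulr_sumr; apply: eq_bigr => i _.
  by rewrite -rA rk !mxE exprMn.
by rewrite mulfK ?gt_eqF // sqrtr_sqr ger0_norm.
Qed.
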